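(* Let $G/N$ and $H/M$ be groups with a Polish cover, and let $\varphi:G/N\to H/M$ be a group homomorphism. Assume that $M$ (with its Polish group topology) has a basis of identity neighborhoods that are closed in the subspace topology on $M$ inherited from $H$. Suppose that $\varphi$ has a lift $f:G\to H$ that is Borel and continuous on an identity neighborhood of $G$. Then: (1) $\varphi$ has an approximately multiplicative, locally continuous Borel lift; (2) if $G$ is locally compact and $f$ is also locally bounded, then $\varphi$ has an approximately multiplicative, locally continuous, and locally bounded Borel lift.
   Context: A subgroup $N$ of a Polish group $G$ is a Polish subgroup if it carries a (necessarily unique) Polish group topology for which the inclusion $N\to G$ is continuous. A group with a Polish cover is a quotient group $G/N$ where $G$ is a Polish group and $N$ is a normal Polish subgroup of $G$ (the pair $(G,N)$ is part of the data). A lift of a group homomorphism $\varphi:G/N\to H/M$ is a function $f:G\to H$ with $\varphi(gN)=f(g)M$ for all $g\in G$. For a Borel lift $f$ of $\varphi$, the multiplicative defect is $\delta f:G\times G\to M$, $\delta f(x,y)=f(x)f(y)f(xy)^{-1}$. The lift $f$ is approximately multiplicative if $f(1)=1$ and $\delta f:G\times G\to M$ is continuous at $(1,1)$ with respect to the Polish group topology of $M$. A function $u:X\to Y$ between Polish groups is locally continuous if it is continuous on an identity neighborhood of $X$; when $X$ is locally compact, $u$ is locally bounded if $u(C)$ has compact closure in $Y$ for every compact $C\subseteq X$. *)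

(* Defs.v *)
From HB Require Import structures.
From mathcomp Require Import all_boot.
From mathcomp Require Import boolp classical_sets functions cardinality reals.
From mathcomp Require Import topology measurable_structure.

Set Implicit Arguments.
Unset Strict Implicit.
Unset Printing Implicit Defensive.

Local Open Scope classical_set_scope.
Local Open Scope group_scope.
Local Open Scope quotient_scope.

(* Completeness is spelled out because the library's completeType is restricted
   to pointed types. *)
Definition completely_metrizable (R : realType) (T : topologicalType) : Prop :=
  exists (X : metricType R) (h : T -> X) (k : X -> T),
    [/\ cancel h k, cancel k h, continuous h, continuous k &
        forall F : set_system X, ProperFilter F -> cauchy F ->
          exists x : X, F --> x].

Definition separable (T : topologicalType) : Prop :=
  exists D : set T, countable D /\ dense D.

Definition polish_space (R : realType) (T : topologicalType) : Prop :=
  separable T /\ completely_metrizable R T.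

HB.mixin Record isTopologicalGroup G & Topological G & Group G := {
  mulg_continuous : continuous (fun x : G * G => x.1 * x.2);
  invg_continuous : continuous (fun x : G => x^-1)
}.

#[short(type="topologicalGroupType")]
HB.structure Definition TopologicalGroup :=
  {G of Topological G & Group G & isTopologicalGroup G}.

HB.mixin Record isPolish (R : realType) T & Topological T := {
  polishP : polish_space R T
}.

#[short(type="polishGroupType")]
HB.structure Definition PolishGroup (R : realType) :=
  {G of TopologicalGroup G & isPolish R G}.

(* A normal Polish subgroup of G is a group N on the subtype of the elements of
   G satisfying S, with val : N -> G as inclusion.  Its topology is a Polish
   group topology of its own, in general finer than the topology induced
   by G. *)
HB.mixin Record isNormalPolishSubgroup (R : realType) (G : polishGroupType R)
    (S : pred G) N & SubGroup G S N & PolishGroup R N := {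
  incl_continuous : continuous (val : N -> G);
  normal_subgroup : forall x g : G, S x -> S (g * x * g^-1)
}.

#[short(type="normalPolishSubgroupType")]
HB.structure Definition NormalPolishSubgroup (R : realType)
    (G : polishGroupType R) (S : pred G) :=
  {N of SubGroup G S N & PolishGroup R N & isNormalPolishSubgroup R G S N}.

Section quotient_group.
Context (R : realType) (G : polishGroupType R) (S : pred G)
        (N : normalPolishSubgroupType S).

Lemma sub1g : S 1.
Proof. by rewrite -(val1 N); exact: (valP (1 : N)). Qed.

Lemma subMg (x y : G) : S x -> S y -> S (x * y).
Proof.
move=> Sx Sy; have := valP ((Sub x Sx : N) * (Sub y Sy : N)).
by rewrite valM !SubK.
Qed.

Lemma subVg (x : G) : S x -> S x^-1.
Proof.
move=> Sx; set u : N := Sub x Sx; suff -> : x^-1 = val u^-1 by exact: valP.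
apply: (mulgI x); rewrite mulgV -[x in RHS](SubK N Sx) -valM mulgV.
by rewrite val1.
Qed.

Definition same_coset (x y : G) : bool := S (x^-1 * y).

Lemma same_coset_refl : reflexive same_coset.
Proof. by move=> x; rewrite /same_coset mulVg sub1g. Qed.

Lemma same_coset_sym : symmetric same_coset.
Proof.
move=> x y; apply/idP/idP => /subVg; by rewrite /same_coset invgM invgK.
Qed.

Lemma same_coset_trans : transitive same_coset.
Proof.
by move=> y x z /subMg /[apply]; rewrite mulgA mulgK.
Qed.

Canonical same_coset_equiv :=
  EquivRel same_coset same_coset_refl same_coset_sym same_coset_trans.

Definition quotient_group : Type := {eq_quot same_coset_equiv}.

HB.instance Definition _ := Choice.on quotient_group.
HB.instance Definition _ := EqQuotient.on quotient_group.

(* the left coset gN *)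
Definition lcoset_class (g : G) : quotient_group := \pi_quotient_group g.

Lemma eq_lcoset_class (x y : G) : lcoset_class x = lcoset_class y <-> S (x^-1 * y).
Proof. by split=> [/eqmodP|Sxy]; last apply/eqmodP. Qed.

Definition quot_mul (a b : quotient_group) := lcoset_class (repr a * repr b).
Definition quot_inv (a : quotient_group) := lcoset_class (repr a)^-1.

Lemma repr_cosetP (x : G) : S (x^-1 * repr (lcoset_class x)).
Proof. by apply/eq_lcoset_class; rewrite /lcoset_class reprK. Qed.

Lemma coset_repr (a : quotient_group) : lcoset_class (repr a) = a.
Proof. exact: reprK. Qed.

Lemma quot_mulE (x y : G) : quot_mul (lcoset_class x) (lcoset_class y) = lcoset_class (x * y).
Proof.
apply/esym/eq_lcoset_class; rewrite invgM.
have Sx := repr_cosetP x; have Sy := repr_cosetP y.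
have -> : y^-1 * x^-1 * (repr (lcoset_class x) * repr (lcoset_class y)) =
  (y^-1 * (x^-1 * repr (lcoset_class x)) * y^-1^-1) * (y^-1 * repr (lcoset_class y)).
  by rewrite invgK !mulgA mulgK.
by apply: subMg => //; exact: (@normal_subgroup R G S N).
Qed.

Lemma quot_invE (x : G) : quot_inv (lcoset_class x) = lcoset_class x^-1.
Proof.
apply/eq_lcoset_class; rewrite invgK.
have -> : repr (lcoset_class x) * x^-1 = x * (x^-1 * repr (lcoset_class x)) * x^-1.
  by rewrite mulVKg.
exact/(@normal_subgroup R G S N)/repr_cosetP.
Qed.

Lemma quot_mulA : associative quot_mul.
Proof.
move=> a b c; rewrite -(coset_repr a) -(coset_repr b) -(coset_repr c).
by rewrite !quot_mulE mulgA.
Qed.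

Lemma quot_mul1g : left_id (lcoset_class 1) quot_mul.
Proof. by move=> a; rewrite -(coset_repr a) quot_mulE mul1g. Qed.

Lemma quot_mulg1 : right_id (lcoset_class 1) quot_mul.
Proof. by move=> a; rewrite -(coset_repr a) quot_mulE mulg1. Qed.

Lemma quot_mulVg : left_inverse (lcoset_class 1) quot_inv quot_mul.
Proof. by move=> a; rewrite -(coset_repr a) quot_invE quot_mulE mulVg. Qed.

Lemma quot_mulgV : right_inverse (lcoset_class 1) quot_inv quot_mul.
Proof. by move=> a; rewrite -(coset_repr a) quot_invE quot_mulE mulgV. Qed.

HB.instance Definition _ := isGroup.Build quotient_group
  quot_mulA quot_mul1g quot_mulg1 quot_mulVg quot_mulgV.

Lemma cosetM (x y : G) : lcoset_class (x * y) = lcoset_class x * lcoset_class y.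
Proof. by rewrite -quot_mulE. Qed.

End quotient_group.

Definition borel_fun (X Y : topologicalType) (f : X -> Y) : Prop :=
  forall B : set Y, <<s @open Y >> B -> <<s @open X >> (f @^-1` B).

Definition locally_continuous (X Y : topologicalGroupType) (f : X -> Y) : Prop :=
  exists2 U : set X, nbhs (1 : X) U & {within U, continuous f}.

Definition locally_bounded (X Y : topologicalType) (f : X -> Y) : Prop :=
  forall C : set X, compact C -> compact (closure (f @` C)).

(* The closed sets of initial_topology val are those closed in the topology
   which M inherits from H. *)
Definition has_inherited_closed_nbhs_basis (R : realType)
    (H : polishGroupType R) (S : pred H) (M : normalPolishSubgroupType S) :
    Prop :=
  exists B : set (set M),
    [/\ forall V, B V -> nbhs (1 : M) V,
        forall U, nbhs (1 : M) U -> exists2 V, B V & V `<=` U &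
        forall V, B V -> @closed (initial_topology (val : M -> H)) V].

Section lifts.
Context (R : realType) (G H : polishGroupType R) (SN : pred G) (SM : pred H)
        (N : normalPolishSubgroupType SN) (M : normalPolishSubgroupType SM).

Definition is_lift (phi : quotient_group N -> quotient_group M) (f : G -> H) :
    Prop :=
  forall g : G, phi (lcoset_class N g) = lcoset_class M (f g).

(* The default value 1 of insubd is irrelevant when f is a lift of a
   homomorphism, by val_defect below. *)
Definition defect (f : G -> H) (p : G * G) : M :=
  insubd (1 : M) (f p.1 * f p.2 * (f (p.1 * p.2))^-1).

Lemma val_defect (phi : {multiplicative quotient_group N -> quotient_group M})
    (f : G -> H) (x y : G) :
  is_lift phi f -> val (defect f (x, y)) = f x * f y * (f (x * y))^-1.
Proof.
move=> lf; rewrite /defect insubdK //=.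
have : lcoset_class M (f (x * y)) = lcoset_class M (f x * f y).
  by rewrite cosetM -!lf cosetM gmulfM.
move=> /eq_lcoset_class SM_; have := @normal_subgroup R H SM M _ (f (x * y)) SM_.
by rewrite mulVKg.
Qed.

Definition approximately_multiplicative (f : G -> H) : Prop :=
  f 1 = 1 /\ {for ((1, 1) : G * G), continuous (defect f)}.

End lifts.

(* Main.v *)
(* Because [M] has a neighborhood basis closed for the topology of [H], a map into [M] that is
   continuous into [H] is of the first Baire class into [M], so by the Baire category theorem it
   has a point of continuity in every nonempty open set of a completely metrizable space.  Applied
   to conjugation this shows that [H] acts continuously on [M]; applied to the defect of [f] near
   the identity it gives a point [(a, b)] of continuity with [f] continuous at [a].  The cocycle
   identity then transports this continuity to [(1, 1)] for the lift [x |-> f(a)^-1 f(a x)]. *)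
Require Import Defs.
From mathcomp Require Import all_boot all_order all_algebra.
From mathcomp Require Import boolp classical_sets functions cardinality reals.
From mathcomp Require Import topology measurable_structure.

Set Implicit Arguments.
Unset Strict Implicit.
Unset Printing Implicit Defensive.

Import Order.TTheory GRing.Theory Num.Theory.
Local Open Scope classical_set_scope.
Local Open Scope group_scope.

(** * Complete pseudometrizability and the Baire category theorem *)

(** [T] is presented as a retract of a complete pseudometric space, a form stable under binary
    products and strong enough for the Baire argument. *)
Definition completely_pseudometrizable (R : realType) (T : topologicalType) :
    Prop :=
  exists (X : pseudoMetricType R) (h : T -> X) (k : X -> T),
    [/\ cancel h k, continuous h, continuous k &
        forall F : set_system X, ProperFilter F -> cauchy F ->
          exists x : X, F --> x].

Lemma completely_metrizable_pseudo (R : realType) (T : topologicalType) :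
  completely_metrizable R T -> completely_pseudometrizable R T.
Proof. by move=> [X [h [k [hK _ ch ck cX]]]]; exists X, h, k. Qed.

Lemma completely_pseudometrizableX (R : realType) (T1 T2 : topologicalType) :
  completely_pseudometrizable R T1 -> completely_pseudometrizable R T2 ->
  completely_pseudometrizable R (T1 * T2)%type.
Proof.
move=> [X1 [h1 [k1 [hK1 ch1 ck1 cX1]]]] [X2 [h2 [k2 [hK2 ch2 ck2 cX2]]]].
exists (X1 * X2)%type, (fun p => (h1 p.1, h2 p.2)), (fun p => (k1 p.1, k2 p.2)).
split.
- by move=> [x y] /=; rewrite hK1 hK2.
- move=> [x y]; apply: cvg_pair => /=.
  + exact: (cvg_comp fst h1 cvg_fst (ch1 x)).
  + exact: (cvg_comp snd h2 cvg_snd (ch2 y)).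
- move=> [x y]; apply: cvg_pair => /=.
  + exact: (cvg_comp fst k1 cvg_fst (ck1 x)).
  + exact: (cvg_comp snd k2 cvg_snd (ck2 y)).
- move=> F FF /cauchyP Fc.
  have [x1 x1P] : exists x1, fst @ F --> (x1 : X1).
    apply: cX1; apply: cauchy_exP => e e0; have [p Fp] := Fc e e0.
    by exists p.1; change (F (fst @^-1` ball p.1 e)); apply: filterS Fp => q [].
  have [x2 x2P] : exists x2, snd @ F --> (x2 : X2).
    apply: cX2; apply: cauchy_exP => e e0; have [p Fp] := Fc e e0.
    by exists p.2; change (F (snd @^-1` ball p.2 e)); apply: filterS Fp => q [].
  exists (x1, x2); apply: cvg_trans (cvg_pair x1P x2P).
  by move=> A; change (F [set q | A (q.1, q.2)] -> F A); apply: filterS => -[].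
Qed.

(** Nested nonempty open sets, each with closure inside the previous one and with images under [h]
    in balls of radius tending to 0, generate a filter whose image under [h] is Cauchy; [k] of its
    limit lies in all of them. *)
Lemma baire (R : realType) (T : topologicalType) (W : set T)
    (P : nat -> set T) :
  completely_pseudometrizable R T -> open W -> W !=set0 ->
  (forall n, open (P n)) ->
  (forall n Q, open Q -> Q !=set0 -> Q `<=` W -> Q `&` P n !=set0) ->
  exists2 x, W x & forall n, P n x.
Proof.
move=> [X [h [k [hK ch ck cX]]]] oW W0 oP dP.
pose eps (n : nat) : R := (n.+1%:R^-1)%R.
pose good (A : set T) := [/\ open A, A !=set0 & A `<=` W].
have step n (A : set T) : good A -> exists A' : set T, good A' /\
    [/\ closure A' `<=` A, A' `<=` P n &
        exists x, A' `<=` h @^-1` ball x (eps n)].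
  move=> [oA A0 AW]; have [x [Ax Px]] := dP n A oA A0 AW.
  have nA : nbhs x (A `&` P n) by apply: open_nbhs_nbhs; split=> //; exact: openI.
  have : nbhs (h x) (k @^-1` (A `&` P n)) by apply: ck; rewrite hK.
  move=> /nbhs_ballP [e /= e0 eA].
  (* Half of [e] keeps the closure of [A'] inside [A] and [P n] by the triangle inequality; [eps n]
     bounds the size of [A']. *)
  pose d := (Num.min (e / 2) (eps n))%R.
  have d0 : (0 < d)%R by rewrite lt_min divr_gt0 // invr_gt0 ltr0Sn.
  pose A' := (h @^-1` ball (h x) d)°.
  have A'x : A' x by apply: ch; exact: nbhsx_ballx.
  have cA' : closure A' `<=` A `&` P n.
    move=> y cy; have := cy (h @^-1` ball (h y) d).
    case; first by apply: ch; exact: nbhsx_ballx.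
    move=> z [/nbhs_singleton /= xz /ball_sym zy].
    have : ball (h x) e (h y).
      rewrite (splitr e); apply: (@ball_triangle _ _ (h z)).
        by apply: (le_ball _ xz); rewrite ge_min lexx.
      by apply: (le_ball _ zy); rewrite ge_min lexx.
    by move=> /eA; rewrite /preimage /= hK.
  exists A'; split; first split.
  - exact: open_interior.
  - by exists x.
  - by move=> y /subset_closure /cA' [/AW].
  - split; first by move=> y /cA' [].
    + by move=> y /subset_closure /cA' [].
    + exists (h x) => y /interior_subset; apply: le_ball.
      by rewrite ge_min lexx orbT.
(* Carrying the stage number beside the set turns the stage-dependent choice into a single relation
   for [dependent_choice]. *)
have next (p : nat * {A : set T | good A}) : {q : nat * {A : set T | good A} |
    q.1 = p.1.+1 /\
    [/\ closure (sval q.2) `<=` sval p.2, sval q.2 `<=` P p.1 &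
        exists x, sval q.2 `<=` h @^-1` ball x (eps p.1)]}.
  case: p => n [A gA]; have /cid [A' [gA' A'P]] := step n A gA.
  by exists (n.+1, exist _ A' gA').
have gW : good W by split.
have [s [s0 sS]] := dependent_choice next (0, exist _ W gW).
have s1 n : (s n).1 = n by elim: n => [|n IH]; rewrite ?s0// (sS n).1 IH.
pose A n := sval (s n).2.
have A0 n : A n !=set0 by case: (svalP (s n).2).
have AS n : [/\ closure (A n.+1) `<=` A n, A n.+1 `<=` P n &
    exists x, A n.+1 `<=` h @^-1` ball x (eps n)].
  by have := (sS n).2; rewrite s1.
have Amono m n : (m <= n)%N -> A n `<=` A m.
  elim: n => [|n IH]; first by rewrite leqn0 => /eqP ->.
  rewrite leq_eqVlt => /predU1P[->//|/IH nm].
  by move=> x /subset_closure; have [cl _ _] := AS n; move=> /cl /nm.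
pose F : set_system T := filter_from [set: nat] A.
have FF : ProperFilter F.
  apply: filter_from_proper; last by move=> n _; exact: A0.
  apply: filter_from_filter; first by exists 0.
  move=> m n _ _; exists (maxn m n) => // x Ax.
  by split; apply: Amono Ax; rewrite ?leq_maxl ?leq_maxr.
have [x Fx] : exists x : X, h @ F --> x.
  apply: cX; apply: cauchy_exP => e e0.
  pose n := Num.truncn e^-1.
  have en : (eps n < e)%R.
    rewrite /eps -(invrK e) ltf_pV2 ?posrE ?invr_gt0 ?ltr0Sn //.
    by rewrite truncnS_gt.
  have [_ _ [y yP]] := AS n; exists y, n.+1 => // z /yP.
  by apply: le_ball; exact: ltW.
(* Since [k] is continuous and undoes [h], the filter [F] itself converges to [k x], which is
   therefore adherent to each [A n]. *)
have clx n : closure (A n) (k x).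
  move=> B Bx; have : F B.
    have := ck x B Bx => /Fx; rewrite /nbhs /= /fmap /=.
    by apply: filterS => y; rewrite /preimage /= hK.
  move=> [m _ mB]; have [y ym] := A0 (maxn m n).
  exists y; split; first by apply: Amono ym; rewrite leq_maxr.
  by apply: mB; apply: Amono ym; rewrite leq_maxl.
have Ax n : A n (k x) by have [cl _ _] := AS n; apply: cl.
exists (k x); first by have := Ax 0; rewrite /A s0.
by move=> n; have [_ AP _] := AS n; apply: AP.
Qed.

(** * Limits in topological groups *)

Section topological_group.
Context (G : topologicalGroupType) (T : Type) (F : set_system T).
Hypothesis FF : Filter F.

Lemma cvg_mulg (f g : T -> G) (a b : G) :
  f @ F --> a -> g @ F --> b -> f x * g x @[x --> F] --> a * b.
Proof.
move=> fa gb.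
exact: (cvg_comp (fun x => (f x, g x)) (fun p => p.1 * p.2)
  (cvg_pair fa gb) (mulg_continuous (a, b))).
Qed.

Lemma cvg_invg (f : T -> G) (a : G) : f @ F --> a -> (f x)^-1 @[x --> F] --> a^-1.
Proof. by move=> fa; exact: (cvg_comp f _ fa (invg_continuous a)). Qed.

End topological_group.

Lemma mulg_cvg (G : topologicalGroupType) (a x : G) : a * y @[y --> x] --> a * x.
Proof. by apply: cvg_mulg; [exact: cvg_cst|exact: cvg_id]. Qed.
Arguments mulg_cvg {G} a x [t] _.

Lemma nbhs1_divl (G : topologicalGroupType) (U : set G) : nbhs 1 U ->
  exists2 V : set G, nbhs 1 V & forall x y, V x -> V y -> U (x^-1 * y).
Proof.
have : p.1^-1 * p.2 @[p --> ((1, 1) : G * G)] --> (1 : G).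
  rewrite -[X in _ --> X]mulg1 -[X in _ --> X * _]invg1.
  by apply: cvg_mulg; [apply: cvg_invg; exact: cvg_fst|exact: cvg_snd].
move=> /[apply] -[[V1 V2] /= [n1 n2] V12].
exists (V1 `&` V2); first exact: filterI.
by move=> x y [Vx _] [_ Vy]; apply: (V12 (x, y)).
Qed.

(** * Continuity points of maps into [M] *)

Lemma completely_metrizable_nbhs_basis (R : realType) (T : topologicalType)
    (x : T) : completely_metrizable R T ->
  exists U : nat -> set T, (forall n, nbhs x (U n)) /\
    forall A, nbhs x A -> exists n, U n `<=` A.
Proof.
move=> [X [h [k [hK _ ch ck _]]]].
exists (fun n => h @^-1` ball (h x) (n.+1%:R^-1)%R); split.
  by move=> n; apply: ch; apply: nbhsx_ballx; rewrite invr_gt0 ltr0Sn.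
move=> A xA; have : nbhs (h x) (k @^-1` A) by apply: ck; rewrite hK.
move=> /nbhs_ballP [e /= e0 eA]; exists (Num.truncn e^-1) => y /= xy.
rewrite -(hK y); apply: eA; apply: (le_ball _ xy); apply: ltW.
by rewrite -[ltRHS]invrK ltf_pV2 ?posrE ?invr_gt0 ?ltr0Sn ?truncnS_gt.
Qed.

Lemma separable_seq (T : topologicalType) : [set: T] !=set0 -> separable T ->
  exists d : nat -> T,
    forall (x : T) (A : set T), nbhs x A -> exists n, A (d n).
Proof.
move=> T0 [D [cD dD]]; have /pfcard_geP[D0|[d]] := cD.
  by have [x] := dD _ T0 openT; rewrite D0 => -[].
exists d => x A; rewrite nbhsE => -[O [oO Ox] OA].
have [y [Oy Dy]] := dD O (ex_intro _ x Ox) oO.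
have [n _ ny] := @surj _ _ _ _ d y Dy; exists n.
by apply: OA; rewrite ny.
Qed.

(* The preimage under [theta] of a translate of a basic neighborhood is closed
   relative to [W], and countably many such preimages cover [W]. *)
Lemma inherited_continuity_point (R : realType) (H : polishGroupType R)
    (S : pred H) (M : normalPolishSubgroupType S) (X : topologicalType)
    (W : set X) (theta : X -> M) :
  has_inherited_closed_nbhs_basis M -> completely_pseudometrizable R X ->
  open W -> W !=set0 ->
  (forall x, W x -> {for x, continuous (val \o theta : X -> H)}) ->
  exists2 x, W x & {for x, continuous theta}.
Proof.
move=> [B [Bnbhs Bbasis Bclosed]] cX oW W0 ctheta.
have [sM mM] := polishP (s := M).
have [U [nU Ubasis]] := completely_metrizable_nbhs_basis 1 mM.
have [d dP] := separable_seq (ex_intro _ (1 : M) I) sM.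
have /choice[V VP] n : exists V : set M, B V /\
    forall x y, V x -> V y -> U n (x^-1 * y).
  have [Q nQ QU] := nbhs1_divl (nU n); have [V BV VQ] := Bbasis _ nQ.
  by exists V; split=> // x y /VQ Qx /VQ; exact: QU.
(* By the choice of [V n], the values of [theta] at two points of [E n i] differ by an element of
   [U n]. *)
pose E n i := [set x | V n ((d i)^-1 * theta x)].
have Ecover n x : exists i, E n i x.
  apply: (dP (theta x) [set m | V n (m^-1 * theta x)]).
  have : m^-1 * theta x @[m --> theta x] --> (1 : M).
    rewrite -[X in _ --> X](mulVg (theta x)).
    by apply: cvg_mulg; [exact: invg_continuous|exact: cvg_cst].
  move=> /(_ (V n)); apply; apply: Bnbhs; by case: (VP n).
have oE n i : open (W `&` ~` E n i).
  (* [V n] is the trace on [M] of the complement of an open set [O] of [H], so lying outside [E n i]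
     is detected by [val \o theta], which is continuous on [W]. *)
  have [/Bclosed VC _] := VP n; move: (VC); rewrite -openC => -[O oO OV].
  rewrite openE => x [Wx Ex]; apply: filterI; first exact: open_nbhs_nbhs.
  have Vval m : V n m <-> ~ O (val m).
    have -> : O (val m) = (~` V n) m by rewrite -OV.
    by split=> [Vm /(_ Vm)//|]; apply: contrapT.
  have /= tx : val (d i)^-1 * val (theta y) @[y --> x] -->
      val ((d i)^-1 * theta x).
    by rewrite valM; apply: cvg_mulg; [exact: cvg_cst|exact: ctheta].
  have nO : nbhs (val ((d i)^-1 * theta x)) O.
    by apply: open_nbhs_nbhs; split=> //; apply: contrapT => /Vval.
  have {tx nO} : \forall y \near x, O (val (d i)^-1 * val (theta y)) := tx _ nO.
  by apply: filterS => y Oy /Vval; rewrite valM.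
(* If [Q] missed all the interiors, the complements of the [E n i] would be dense in [Q], and Baire
   would give a point of [Q] lying in no [E n i]. *)
have Eint n Q : open Q -> Q !=set0 -> Q `<=` W ->
    Q `&` (W `&` \bigcup_i (E n i)°) !=set0.
  move=> oQ Q0 QW; apply: contrapT => Qn.
  have [| x Qx xE] := @baire R X Q (fun i => W `&` ~` E n i) cX oQ Q0 (oE n).
    move=> i O oO [x Ox] OQ; apply: contrapT => On; apply: Qn.
    exists x; split; first exact: OQ.
    split; first exact/QW/OQ.
    exists i => //; rewrite /interior; apply: filterS (open_nbhs_nbhs (conj oO Ox)).
    move=> y Oy; apply: contrapT => Ey; apply: On; exists y; split=> //.
    by split=> //; exact/QW/OQ.
  by have [i Ei] := Ecover n x; have [_] := xE i; exact.
(* A second use of Baire gives a point which, for every [n], is interior to some [E n i]; near it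
   [theta] varies only within [U n]. *)
have [||x Wx xE] :=
  @baire R X W (fun n => W `&` \bigcup_i (E n i)°) cX oW W0.
- by move=> n; apply: openI => //; apply: bigcup_open => i _; exact: open_interior.
- exact: Eint.
exists x => // A xA.
rewrite -(mulg1 (theta x)) in xA.
have [n UnA] := Ubasis _ (mulg_cvg _ _ xA); have [_ [i _ Ex]] := xE n.
have [_ VU] := VP n; apply: filterS (Ex) => y Ey.
rewrite /preimage /= -[theta y](mulVKg (theta x)); apply: UnA.
have := VU _ _ (nbhs_singleton Ex) Ey.
by rewrite invgM invgK mulgA mulgK.
Qed.

(** * The conjugation action of [H] on [M] *)

Section conjugation.
Context (R : realType) (H : polishGroupType R) (S : pred H)
        (M : normalPolishSubgroupType S).
Hypothesis M_basis : has_inherited_closed_nbhs_basis M.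

Definition conj_sub (h : H) (m : M) : M := insubd 1 (h * val m * h^-1).

Lemma val_conj_sub (h : H) (m : M) : val (conj_sub h m) = h * val m * h^-1.
Proof. by rewrite insubdK //; apply: (@normal_subgroup R H S M); exact: valP. Qed.

Lemma val_subV (m : M) : val m^-1 = (val m)^-1.
Proof. by apply: (mulgI (val m)); rewrite -valM !mulgV val1. Qed.

Lemma conj_subM (h : H) (m1 m2 : M) :
  conj_sub h (m1 * m2) = conj_sub h m1 * conj_sub h m2.
Proof. by apply: val_inj; rewrite !(valM, val_conj_sub) !mulgA mulgVK. Qed.

Lemma conj_sub1 (h : H) : conj_sub h 1 = 1.
Proof. by apply: val_inj; rewrite val_conj_sub !val1 mulg1 mulgV. Qed.

Lemma conj_sub_comp (h1 h2 : H) (m : M) :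
  conj_sub h1 (conj_sub h2 m) = conj_sub (h1 * h2) m.
Proof. by apply: val_inj; rewrite !val_conj_sub invgM !mulgA. Qed.

Lemma conj_subK (h : H) : cancel (conj_sub h) (conj_sub h^-1).
Proof.
move=> m; rewrite conj_sub_comp mulVg; apply: val_inj.
by rewrite val_conj_sub mul1g invg1 mulg1.
Qed.

Lemma polish_completely_pseudometrizable (G : polishGroupType R) :
  completely_pseudometrizable R G.
Proof. by apply: completely_metrizable_pseudo; case: (polishP (s := G)). Qed.

(** Conjugation is continuous into [H], hence has one point of continuity as a map into [M]; being a
    homomorphism, it is then continuous everywhere. *)
Lemma conj_sub_continuous (h : H) : continuous (conj_sub h).
Proof.
have [||m0 _ cm0 m] := @inherited_continuity_point R H S M M setT (conj_sub h)
  M_basis (polish_completely_pseudometrizable M) openT.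
- by exists 1.
- move=> m _; rewrite /prop_for.
  have -> : val \o conj_sub h = fun x => h * val x * h^-1.
    by apply/funext => x; exact: val_conj_sub.
  apply: cvg_mulg; last exact: cvg_cst.
  by apply: cvg_mulg; [exact: cvg_cst|exact: incl_continuous].
(* Left translation by [m0 * m^-1] carries [m] to the continuity point [m0]. *)
have -> : conj_sub h =
    fun x => conj_sub h (m * m0^-1) * conj_sub h (m0 * m^-1 * x).
  by apply/funext => x; rewrite -conj_subM !mulgA mulgVK mulgV mul1g.
apply: cvg_mulg; first exact: cvg_cst.
rewrite mulgVK; have := mulg_cvg (m0 * m^-1) m; rewrite mulgVK => cm.
exact: (cvg_comp _ _ cm cm0).
Qed.

(** A point [(h0, m0)] of joint continuity is moved to [(1, 1)]: [h0] is undone by the continuous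
    map [conj_sub h0^-1], and [m0] by dividing by its conjugate under [f x]. *)
Lemma cvg_conj_sub1 (T : Type) (F : set_system T) (f : T -> H) (g : T -> M) :
  Filter F -> f @ F --> (1 : H) -> g @ F --> (1 : M) ->
  conj_sub (f x) (g x) @[x --> F] --> (1 : M).
Proof.
move=> FF f1 g1.
have [||[h0 m0] _ c0] := @inherited_continuity_point R H S M (H * M)%type setT
  (fun p => conj_sub p.1 p.2) M_basis
  (completely_pseudometrizableX (polish_completely_pseudometrizable H)
     (polish_completely_pseudometrizable M)) openT.
- by exists (1, 1).
- move=> [h m] _; rewrite /prop_for.
  have -> : val \o (fun p => conj_sub p.1 p.2) = fun p => p.1 * val p.2 * p.1^-1.
    by apply/funext => p; exact: val_conj_sub.
  apply: cvg_mulg; last by apply: cvg_invg; exact: cvg_fst.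
  apply: cvg_mulg; first exact: cvg_fst.
  exact: (cvg_comp snd (val : M -> H) cvg_snd (incl_continuous m)).
have h0f : h0 * f x @[x --> F] --> h0.
  by rewrite -[X in _ --> X]mulg1; apply: cvg_mulg => //; exact: cvg_cst.
have conj0 (u : T -> M) : u @ F --> (1 : M) ->
    conj_sub (f x) (m0 * u x) @[x --> F] --> m0.
  move=> u1; have m0u : m0 * u x @[x --> F] --> m0.
    by rewrite -[X in _ --> X]mulg1; apply: cvg_mulg => //; exact: cvg_cst.
  have cu : conj_sub (h0 * f x) (m0 * u x) @[x --> F] --> conj_sub h0 m0.
    exact: (cvg_comp (fun x => (h0 * f x, m0 * u x)) _ (cvg_pair h0f m0u) c0).
  have := cvg_comp _ _ cu (@conj_sub_continuous h0^-1 (conj_sub h0 m0)).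
  rewrite conj_subK; apply: cvg_trans; apply: near_eq_cvg; near=> x => /=.
  by rewrite -conj_sub_comp conj_subK.
have : (conj_sub (f x) (m0 * 1))^-1 * conj_sub (f x) (m0 * g x) @[x --> F] -->
    m0^-1 * m0.
  apply: cvg_mulg; last exact: conj0.
  by apply: cvg_invg; apply: conj0; exact: cvg_cst.
rewrite mulVg; apply: cvg_trans; apply: near_eq_cvg; near=> x.
by rewrite mulg1 conj_subM mulKg.
Unshelve. all: by end_near.
Qed.

End conjugation.

(** * Translates of a lift and their defects *)

Section lifts.
Context (R : realType) (G H : polishGroupType R) (SN : pred G) (SM : pred H)
        (N : normalPolishSubgroupType SN) (M : normalPolishSubgroupType SM).
Variable phi : {multiplicative quotient_group N -> quotient_group M}.
Variable f : G -> H.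
Hypothesis f_lift : is_lift phi f.

(** Left division by [f a] normalizes the shifted map to take the value [1] at [1]. *)
Definition translate_lift (a x : G) : H := (f a)^-1 * f (a * x).

Lemma translate_lift_is_lift (a : G) : is_lift phi (translate_lift a).
Proof.
move=> x; apply: (mulgI (lcoset_class M (f a))).
by rewrite -cosetM mulVKg -!f_lift cosetM gmulfM.
Qed.

Hypothesis M_basis : has_inherited_closed_nbhs_basis M.

(** On pairs whose entries and product lie in [U°], the defect read in [H] is a product of values of
    [f] at continuity points and their inverses, hence continuous; these pairs form an open set
    containing [(1, 1)]. *)
Lemma defect_continuity_point (U : set G) : nbhs 1 U ->
  (forall x, U x -> {for x, continuous f}) ->
  exists a b : G, U a /\ {for (a, b), continuous (defect M f)}.
Proof.
move=> nU cU; pose W := [set p : G * G | [/\ U° p.1, U° p.2 & U° (p.1 * p.2)]].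
have cmul (p : G * G) : q.1 * q.2 @[q --> p] --> p.1 * p.2 by exact: mulg_continuous.
have oU := @open_interior _ U.
have nU' (x : G) : U° x -> nbhs x U° by move=> Ux; exact: open_nbhs_nbhs.
have oW : open W.
  rewrite openE => z [/nU' U1 /nU' U2 /nU' U12].
  have n1 : nbhs z (fst @^-1` U°) by case: z U1 {U2 U12} => x y; exact: cvg_fst.
  have n2 : nbhs z (snd @^-1` U°) by case: z U2 {U1 U12 n1} => x y; exact: cvg_snd.
  have n3 : nbhs z [set p | U° (p.1 * p.2)] := cmul z _ U12.
  by apply: filterS (filterI (filterI n1 n2) n3) => p [[]].
have W0 : W !=set0 by exists (1, 1); split; rewrite ?mulg1.
have [|[a b] [/interior_subset Ua _ _] cab] :=
  @inherited_continuity_point R H SM M (G * G)%type W (defect M f) M_basis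
  (completely_pseudometrizableX (polish_completely_pseudometrizable G)
     (polish_completely_pseudometrizable G)) oW W0; last by exists a, b.
move=> [x y] [/= /interior_subset/cU cx /interior_subset/cU cy
  /interior_subset/cU cxy].
rewrite /prop_for.
have -> : val \o defect M f = fun p => f p.1 * f p.2 * (f (p.1 * p.2))^-1.
  by apply/funext => -[u v]; exact: val_defect f_lift.
apply: cvg_mulg; last first.
  by apply: cvg_invg; exact: (cvg_comp _ _ (cmul (x, y)) cxy).
apply: cvg_mulg.
  exact: (cvg_comp fst f cvg_fst cx).
exact: (cvg_comp snd f cvg_snd cy).
Qed.

(* With [eps x y] the conjugate by [(f a)^-1] of the defect at [(a x, y b)],
   all values of [f] at points involving [b] cancel in [defectE]. *)
Lemma translate_lift_approximately_multiplicative (a b : G) :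
  {for a, continuous f} -> {for (a, b), continuous (defect M f)} ->
  approximately_multiplicative M (translate_lift a).
Proof.
move=> ca cab; set A := translate_lift a.
have A1 : A 1 = 1 by rewrite /A /translate_lift mulg1 mulVg.
split=> //.
pose eps (x y : G) : M := conj_sub (f a)^-1 (defect M f (a * x, y * b)).
have epsE x y :
    val (eps x y) = (f a)^-1 * (f (a * x) * f (y * b) * (f (a * x * (y * b)))^-1) * f a.
  by rewrite val_conj_sub invgK (val_defect _ _ f_lift).
(* The first factor is the conjugate by [A x] of [A y * f b * (f (y * b))^-1]; the second is [A x *
   f (y * b) * (f b)^-1 * (A (x * y))^-1]. *)
have defectE x y : defect M A (x, y) =
    conj_sub (A x) (eps y 1 * (eps 1 y)^-1) * (eps x y * (eps (x * y) 1)^-1).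
  have A_lift := translate_lift_is_lift a.
  apply: val_inj; rewrite (val_defect _ _ A_lift) valM val_conj_sub !valM.
  rewrite !val_subV !epsE /A /translate_lift !mulg1 !mul1g !invgM !invgK !mulgA.
  by rewrite ?(mulgK, mulgVK).
pose m := eps 1 1.
have cA : A x @[x --> (1 : G)] --> (1 : H).
  rewrite -[X in _ --> X](mulVg (f a)); apply: cvg_mulg; first exact: cvg_cst.
  have := mulg_cvg a 1; rewrite mulg1 => ca1.
  exact: (cvg_comp _ _ ca1 ca).
(* The arguments of the defect inside [eps] tend to [(a, b)] and conjugation by the fixed [(f a)^-1]
   is continuous on [M], so all four [eps] terms of [defectE] share the limit [m]. *)
have ceps (F : set_system (G * G)) (u v : G * G -> G) : Filter F ->
    u @ F --> (1 : G) -> v @ F --> (1 : G) -> eps (u p) (v p) @[p --> F] --> m.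
  move=> FF u1 v1; have au : a * u p @[p --> F] --> a.
    by rewrite -[X in _ --> X]mulg1; apply: cvg_mulg => //; exact: cvg_cst.
  have vb : v p * b @[p --> F] --> b.
    by rewrite -[X in _ --> X]mul1g; apply: cvg_mulg => //; exact: cvg_cst.
  have cd : defect M f (a * u p, v p * b) @[p --> F] --> defect M f (a, b).
    exact: (cvg_comp (fun p => (a * u p, v p * b)) _ (cvg_pair au vb) cab).
  rewrite /m /eps mulg1 mul1g.
  exact: (cvg_comp _ (conj_sub (f a)^-1) cd
    (@conj_sub_continuous R H SM M M_basis _ _)).
have D11 : defect M A (1, 1) = 1.
  by rewrite defectE mulg1 !mulgV conj_sub1 mulg1.
rewrite /prop_for /continuous_at D11.
have -> : defect M A = fun p => conj_sub (A p.1) (eps p.2 1 * (eps 1 p.2)^-1) *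
    (eps p.1 p.2 * (eps (p.1 * p.2) 1)^-1).
  by apply/funext => -[x y]; exact: defectE.
have c1 : fst @ nbhs ((1, 1) : G * G) --> (1 : G) by exact: cvg_fst.
have c2 : snd @ nbhs ((1, 1) : G * G) --> (1 : G) by exact: cvg_snd.
have c12 : p.1 * p.2 @[p --> ((1, 1) : G * G)] --> (1 : G).
  by rewrite -[X in _ --> X]mulg1; exact: cvg_mulg.
have ccst : (fun _ : G * G => (1 : G)) @ nbhs ((1, 1) : G * G) --> (1 : G).
  exact: cvg_cst.
(* Both quotients of [eps] terms tend to [m * m^-1]; the conjugating element [A p.1] also varies,
   hence the appeal to joint continuity in [cvg_conj_sub1]. *)
rewrite -[X in _ --> X]mulg1; apply: cvg_mulg.
  apply: cvg_conj_sub1 => //; first exact: (cvg_comp _ _ c1 cA).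
  rewrite -[X in _ --> X](mulgV m); apply: cvg_mulg; first exact: ceps.
  by apply: cvg_invg; exact: ceps.
rewrite -[X in _ --> X](mulgV m); apply: cvg_mulg; first exact: ceps.
by apply: cvg_invg; exact: ceps.
Qed.

End lifts.

(** * Borel measurability, local continuity and local boundedness of translates *)

Lemma continuous_borel_fun (X Y : topologicalType) (f : X -> Y) :
  continuous f -> borel_fun f.
Proof.
(* The sets with Borel preimage form a sigma-algebra containing the open sets. *)
move=> cf; apply: smallest_sub; last first.
  by move=> B oB; apply: sub_sigma_algebra; apply: open_comp => // x _; exact: cf.
split.
- by rewrite /= preimage_set0; exact: sigma_algebra0.
- by move=> A bA; exact: (sigma_algebraCD bA).
- by move=> A bA; rewrite /= preimage_bigcup; exact: sigma_algebra_bigcup.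
Qed.

Lemma borel_fun_comp (X Y Z : topologicalType) (g : Y -> Z) (f : X -> Y) :
  borel_fun g -> borel_fun f -> borel_fun (g \o f).
Proof. by move=> bg bf B /bg /bf. Qed.

Section translation.
Context (R : realType) (G H : polishGroupType R).
Implicit Type f : G -> H.

Lemma translate_lift_borel f (a : G) : borel_fun f -> borel_fun (translate_lift f a).
Proof.
move=> bf; apply: (@borel_fun_comp _ _ _ (fun y => (f a)^-1 * y)).
  by apply: continuous_borel_fun => y; exact: mulg_cvg.
apply: borel_fun_comp => //; apply: continuous_borel_fun => x; exact: mulg_cvg.
Qed.

Lemma translate_lift_locally_continuous f (a : G) (U : set G) :
  open U -> U a -> (forall x, U x -> {for x, continuous f}) ->
  locally_continuous (translate_lift f a).
Proof.
move=> oU Ua cU; have oV : open ((fun x => a * x) @^-1` U).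
  by apply: open_comp => // x _; exact: mulg_cvg.
exists ((fun x => a * x) @^-1` U).
  by apply: open_nbhs_nbhs; split=> //=; rewrite mulg1.
rewrite continuous_open_subspace // => x /set_mem Ux.
apply: cvg_mulg; first exact: cvg_cst.
exact: (cvg_comp _ _ (mulg_cvg a x) (cU _ Ux)).
Qed.

Lemma translate_lift_locally_bounded f (a : G) :
  locally_bounded f -> locally_bounded (translate_lift f a).
Proof.
move=> bf C cC; pose K := closure (f @` ((fun x => a * x) @` C)).
have cK : compact K.
  apply: bf; apply: continuous_compact => //.
  by apply: continuous_subspaceT => x; exact: mulg_cvg.
pose L (y : H) := (f a)^-1 * y.
have clLK : closed ((fun y => f a * y) @^-1` K).
  by apply: closed_comp; [move=> y _; exact: mulg_cvg|exact: closed_closure].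
(* The translate of [K] by [(f a)^-1] is compact, and it is closed as the preimage of [K] under left
   multiplication by [f a]. *)
apply: (@subclosed_compact _ _ (L @` K)); first exact: closed_closure.
  apply: continuous_compact => //.
  by apply: continuous_subspaceT => y; exact: mulg_cvg.
have -> : L @` K = (fun y => f a * y) @^-1` K.
  apply/seteqP; split=> [_ [y Ky <-]|y Ky]; first by rewrite /preimage /= mulVKg.
  by exists (f a * y) => //; rewrite /L mulKg.
rewrite [X in _ `<=` X](closure_id _).1 //; apply: closureS => _ [x Cx <-].
rewrite /preimage /= mulVKg; apply: subset_closure.
by exists (a * x) => //; exists x.
Qed.

End translation.

Theorem theorem5p2 (R : realType) (G H : polishGroupType R)
    (SN : pred G) (SM : pred H)
    (N : normalPolishSubgroupType SN) (M : normalPolishSubgroupType SM)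
    (phi : {multiplicative quotient_group N -> quotient_group M})
    (M_basis : has_inherited_closed_nbhs_basis M)
    (f : G -> H) (f_lift : is_lift phi f) (f_borel : borel_fun f)
    (f_cont : locally_continuous f) :
  (exists f' : G -> H,
     [/\ is_lift phi f', borel_fun f', approximately_multiplicative M f' &
         locally_continuous f'])
  /\
  (locally_compact [set: G] -> locally_bounded f ->
   exists f' : G -> H,
     [/\ is_lift phi f', borel_fun f', approximately_multiplicative M f',
         locally_continuous f' & locally_bounded f']).
Proof.
have [U nU cU] := f_cont.
have cU' x : U° x -> {for x, continuous f}.
  have := continuous_subspaceW (@interior_subset _ U) cU.
  rewrite continuous_open_subspace; last exact: open_interior.
  by move=> cf Ux; apply: cf; rewrite inE.
have nU' := nbhs_interior nU.
(* The single translate at [a] witnesses both conclusions; [a] lies in the open set [U°], so [f] is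
   continuous at and around it. *)
have [a [b [Ua cab]]] := defect_continuity_point f_lift M_basis nU' cU'.
have ca := cU' a Ua.
have A_lift := translate_lift_is_lift f_lift a.
have A_borel := translate_lift_borel a f_borel.
have A_am := translate_lift_approximately_multiplicative f_lift M_basis ca cab.
have A_cont := translate_lift_locally_continuous (@open_interior _ U) Ua cU'.
split=> [|_ f_bounded]; exists (translate_lift f a); split=> //.
exact: translate_lift_locally_bounded.
Qed.
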